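(* Let $\mathcal{A}$ be a generic arrangement of $n$ hyperplanes in $\mathbb{R}^k$, $k<n$, and let $X\in\mathcal{L}(\mathcal{B}(n,k,\mathcal{A}))$ be a minimal non-very generic intersection with canonical presentation $\{S_1,\dots,S_m\}$. Then: (1) $2\le\ell_X\le k$; (2) $a_X\ge \ell_X|\bigcup_i S_i|/(k+1)$; (3) $\operatorname{rank}(X)<a_X<\operatorname{rank}(X)+\ell_X$.
   Context: A central arrangement $\mathcal{A}=\{H_1,\dots,H_n\}$ in $\mathbb{R}^k$ ($k<n$), with normals $\alpha_i$, is generic if any $m\le k$ of its hyperplanes intersect in codimension $m$. Identify $\mathbb{R}^n$ with the space of parallel translates via $t\mapsto(H_i+t_i\alpha_i)_i$. For $L\subset[n]$, $|L|=k+1$, $D_L=\{t\mid\bigcap_{i\in L}(H_i+t_i\alpha_i)\ne\emptyset\}$; $\mathcal{B}(n,k,\mathcal{A})=\{D_L\}$ is the discriminantal arrangement with intersection poset $\mathcal{L}(\mathcal{B}(n,k,\mathcal{A}))$. For $|S|\ge k+1$, $D_S=\bigcap_{L\subset S,|L|=k+1}D_L$. $D_S$ is a component of $X$ if $X\subset D_S$ and $X\not\subset D_{S\cup\{j\}}$ for all $j\notin S$; the canonical presentation $\{S_1,\dots,S_m\}$ of $X$ is the set of index sets of all its components. Athanasiadis rank $a_X=\sum_i(|S_i|-k)$; $\operatorname{rank}(X)$ is the codimension; $X$ is very generic if $\operatorname{rank}(X)=a_X$, non-very generic otherwise. A non-very generic $X$ is minimal if every $Y\in\mathcal{L}(\mathcal{B}(n,k,\mathcal{A}))$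 with $Y\supsetneq X$ is very generic. $\ell_X=\min_{j\in\bigcup_iS_i}|\{i\in[m]\mid j\in S_i\}|$. *)

(* Defs.v *)
From mathcomp Require Import all_boot all_order all_algebra.
From mathcomp Require Import boolp classical_sets reals.

Set Implicit Arguments.
Unset Strict Implicit.
Unset Printing Implicit Defensive.

Import GRing.Theory Num.Theory.

Local Open Scope ring_scope.

Definition codim (K : fieldType) (V : vectType K) (U : {vspace V}) : nat :=
  (\dim {:V} - \dim U)%N.

Section Discriminantal.
Variables (R : realType) (n k : nat).

(* A central arrangement is given by its family of normals; the hyperplane
   H_i is the orthogonal of alpha i for the standard scalar product. *)
Variable alpha : 'I_n -> 'rV[R]_k.

Definition hyperplane (i : 'I_n) : {vspace 'rV[R]_k} :=
  lker (linfun (mulmxr (alpha i)^T)).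

Definition generic : Prop :=
  forall I : {set 'I_n}, (#|I| <= k)%N ->
    codim (\bigcap_(i in I) hyperplane i)%VS = #|I|.

Definition translate (i : 'I_n) (c : R) : set 'rV[R]_k :=
  [set x + c *: alpha i | x in [set` hyperplane i]]%classic.

Definition DL (L : {set 'I_n}) : set 'rV[R]_n :=
  [set t | \bigcap_(i in [set` L]) translate i (t 0 i) !=set0]%classic.

(* Only meant for |S| >= k + 1; it agrees with DL S when |S| = k + 1. *)
Definition DS (S : {set 'I_n}) : set 'rV[R]_n :=
  (\bigcap_(L in [set L : {set 'I_n} | L \subset S /\ #|L| = k.+1]) DL L)%classic.

(* All D_L are linear subspaces of R^n, so the elements of the intersection
   poset are represented as {vspace 'rV[R]_n}. The empty family F gives the
   ambient space. *)
Definition in_poset (X : {vspace 'rV[R]_n}) : Prop :=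
  exists2 F : {set {set 'I_n}},
    forall L, L \in F -> #|L| = k.+1 &
    ([set` X] = \bigcap_(L in [set` F]) DL L)%classic.

Definition is_component (X : {vspace 'rV[R]_n}) (S : {set 'I_n}) : Prop :=
  [/\ (k.+1 <= #|S|)%N,
      ([set` X] `<=` DS S)%classic &
      forall j, j \notin S -> ~ ([set` X] `<=` DS (j |: S))%classic].

Definition presentation (X : {vspace 'rV[R]_n}) : {set {set 'I_n}} :=
  [set S : {set 'I_n} | `[< is_component X S >]]%SET.

Definition ath_rank (X : {vspace 'rV[R]_n}) : nat :=
  (\sum_(S in presentation X) (#|S| - k))%N.

Definition very_generic (X : {vspace 'rV[R]_n}) : Prop :=
  codim X = ath_rank X.

Definition minimal_non_very_generic (X : {vspace 'rV[R]_n}) : Prop :=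
  [/\ in_poset X, ~ very_generic X &
      forall Y : {vspace 'rV[R]_n}, in_poset Y ->
        (X <= Y)%VS -> Y != X -> very_generic Y].

Definition multiplicity (X : {vspace 'rV[R]_n}) (j : 'I_n) : nat :=
  #|[pred S in presentation X | j \in S]|.

(* Every multiplicity is at most #|presentation X|, so this default value does
   not affect the minimum over a nonempty union. *)
Definition ell (X : {vspace 'rV[R]_n}) : nat :=
  \big[minn/#|presentation X|]_(j in finset.cover (presentation X)) multiplicity X j.

End Discriminantal.

(* Main.v *)
(* Choose an index j lying in exactly ell_X components of X, and let Y be the
   intersection of the D_L containing X with L avoiding j. Translating H_j
   alone preserves Y but not X, so Y is strictly larger than X and, by
   minimality, very generic. Every S \ j with S a component of X is a component
   of Y as soon as it has more than k elements, so
   a_X - ell_X <= a_Y = rank(Y) < rank(X), which is the hard half of (3); since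
   rank(X) < a_X it also forces ell_X >= 2. Double counting the incidences
   between indices and components, with |S| <= (k+1)(|S| - k), gives (2).
   Finally, writing U for the union of the components, X contains D_U, strictly
   because otherwise U would be the only component; hence
   rank(X) < |U| - k, and the three bounds together exclude ell_X > k. *)

Require Import Defs.
From mathcomp Require Import all_boot all_order all_algebra.
From mathcomp Require Import boolp classical_sets reals.
From mathcomp Require Import zify.

Set Implicit Arguments.
Unset Strict Implicit.
Unset Printing Implicit Defensive.

Import GRing.Theory Num.Theory.

Local Open Scope ring_scope.

(** * Codimension of subspaces *)

Lemma codimS (K : fieldType) (V : vectType K) (A B : {vspace V}) :
  (A <= B)%VS -> (codim B <= codim A)%N.
Proof. by move=> sAB; rewrite leq_sub2l ?dimvS. Qed.

Lemma codim_eq (K : fieldType) (V : vectType K) (A B : {vspace V}) :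
  (A <= B)%VS -> codim A = codim B -> A = B.
Proof.
move=> sAB eq_codim; apply/eqP; rewrite -(dimv_leqif_eq sAB) eqn_leq dimvS //.
by move: eq_codim (dimvS (subvf A)) (dimvS (subvf B)); rewrite /codim; lia.
Qed.

Lemma codim_cap (K : fieldType) (V : vectType K) (A B : {vspace V}) :
  (codim (A :&: B) <= codim A + codim B)%N.
Proof.
move: (dimv_sum_cap A B) (dimvS (subvf (A + B))) (dimvS (subvf A)).
by move: (dimvS (subvf B)); rewrite /codim; lia.
Qed.

Lemma codim_bigcap (K : fieldType) (V : vectType K) (I : finType) (P : pred I)
    (A : I -> {vspace V}) :
  (codim (\bigcap_(i | P i) A i)%VS <= \sum_(i | P i) codim (A i))%N.
Proof.
elim/big_rec2: _ => [|i m B _ leBm]; first by rewrite /codim subnn.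
by apply: leq_trans (codim_cap _ _) _; rewrite leq_add2l.
Qed.

Lemma codim_lker (K : fieldType) (V W : vectType K) (f : 'Hom(V, W)) :
  (codim (lker f) <= dim W)%N.
Proof.
move: (limg_ker_dim f fullv) (dimvS (subvf (limg f))).
by rewrite capfv /codim !dimvf; lia.
Qed.

Lemma exists_subset_card (T : finType) (A : {set T}) m :
  (m <= #|A|)%N -> exists2 B : {set T}, B \subset A & #|B| = m.
Proof.
case/card_geqP=> s [s_uniq s_size sA]; exists [set:: s].
  by apply/fintype.subsetP=> x; rewrite inE; apply: sA.
by rewrite cardsE (card_uniqP s_uniq).
Qed.

Lemma memv_bigcapP (K : fieldType) (V : vectType K) (I : finType)
    (P : pred I) (A : I -> {vspace V}) v :
  reflect (forall i, P i -> v \in A i) (v \in \bigcap_(i | P i) A i)%VS.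
Proof. by rewrite memvE; apply: subv_bigcapP. Qed.

(** * Concurrent translates as linear subspaces *)

Section Translates.
Variables (R : realType) (n k : nat) (alpha : 'I_n -> 'rV[R]_k).
Hypothesis alpha_neq0 : forall i, alpha i != 0.

Definition sqnorm (i : 'I_n) : R := (alpha i *m (alpha i)^T) 0 0.

(* The hyperplane [translate i c] contains [x] iff [c] is the [i]-th entry of
   [offsets x]. *)
Definition offsets : 'Hom('rV[R]_k, 'rV[R]_n) :=
  linfun (mulmxr (\matrix_(a, i) (alpha i 0 a / sqnorm i))).

Definition coordinate (i : 'I_n) : 'Hom('rV[R]_n, 'M[R]_1) := linfun (col i).

(* [D_S] as a subspace, also when [|S| <= k]; it is then the whole space if
   the arrangement is generic. *)
Definition concurrent (S : {set 'I_n}) : {vspace 'rV[R]_n} :=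
  (limg offsets + \bigcap_(i in S) lker (coordinate i))%VS.

Lemma mem_lker_coordinate i t : (t \in lker (coordinate i)) = (t 0 i == 0).
Proof.
rewrite memv_ker lfunE; apply/eqP/eqP => [/matrixP/(_ 0 0)|ti0];
  rewrite ?mxE //.
by apply/matrixP=> a b; rewrite !mxE !ord1.
Qed.

Lemma offsetsE x i : offsets x 0 i = (x *m (alpha i)^T) 0 0 / sqnorm i.
Proof.
rewrite lfunE /= !mxE mulr_suml; apply: eq_bigr => a _.
by rewrite !mxE mulrA.
Qed.

Lemma sqnorm_neq0 i : sqnorm i != 0.
Proof.
apply: contra (alpha_neq0 i) => /eqP; rewrite /sqnorm mxE => sum0.
apply/eqP/rowP=> a; rewrite [RHS]mxE; apply/eqP; rewrite -sqrf_eq0; apply/eqP.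
have /psumr_eq0P : \sum_j alpha i 0 j ^+ 2 = 0.
  by rewrite -[RHS]sum0; apply: eq_bigr => j _; rewrite mxE expr2.
by apply=> // j _; apply: sqr_ge0.
Qed.

Lemma offsets_eq0 x i : (offsets x 0 i == 0) = (x \in hyperplane alpha i).
Proof.
rewrite offsetsE mulf_eq0 invr_eq0 (negPf (sqnorm_neq0 i)) orbF.
rewrite memv_ker lfunE /=.
apply/eqP/eqP => [x0|->]; rewrite ?mxE //.
by apply/matrixP=> a b; rewrite !ord1 x0 !mxE.
Qed.

Lemma concurrentP (S : {set 'I_n}) (t : 'rV[R]_n) :
  reflect (exists x, forall i, i \in S -> offsets x 0 i = t 0 i)
          (t \in concurrent S).
Proof.
apply: (iffP memv_addP) => [|[x tx]].
  case=> _ /memv_imgP[x _ ->] [v /memv_bigcapP v0 ->].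
  exists x => i /v0; rewrite mem_lker_coordinate => /eqP vi0.
  by rewrite [RHS]mxE vi0 addr0.
exists (offsets x); first exact: memv_img (memvf x).
exists (t - offsets x); last by rewrite addrC subrK.
apply/memv_bigcapP=> i iS.
by rewrite mem_lker_coordinate !mxE tx // subrr.
Qed.

Lemma translateP i c x :
  reflect (offsets x 0 i = c) `[< (translate alpha i c x)%classic >].
Proof.
apply: (iffP (asboolP _)) => [[y yH <-]|<-].
  have yi0 : offsets y 0 i = 0 by apply/eqP; rewrite offsets_eq0; apply: yH.
  rewrite linearD linearZ !mxE yi0 add0r offsetsE mulfV ?mulr1 //.
  exact: sqnorm_neq0.
(* The witness is the orthogonal projection of [x] onto [hyperplane alpha i]. *)
exists (x - offsets x 0 i *: alpha i); last by rewrite subrK.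
change (x - offsets x 0 i *: alpha i \in hyperplane alpha i).
rewrite -offsets_eq0 linearB linearZ !mxE [offsets (alpha i) 0 i]offsetsE.
by rewrite mulfV ?mulr1 ?subrr // sqnorm_neq0.
Qed.

Lemma DLE L : (DL alpha L = [set` concurrent L])%classic.
Proof.
apply/seteqP; split=> [t [x tx]|t /concurrentP[x tx]].
  by apply/concurrentP; exists x => i iL; apply/translateP/asboolP/tx.
by exists x => i iL; apply/asboolP/translateP/tx.
Qed.

Lemma concurrentS (S T : {set 'I_n}) :
  S \subset T -> (concurrent T <= concurrent S)%VS.
Proof.
move=> sST; apply/subvP=> t /concurrentP[x tx].
by apply/concurrentP; exists x => i /(fintype.subsetP sST)/tx.
Qed.

(** * Consequences of genericity *)

Hypothesis alpha_generic : generic alpha.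

(** By genericity [k] of the hyperplanes meet only in the origin, so [k] offsets determine a
    point. *)
Lemma offsets_inj (S : {set 'I_n}) x y : (k <= #|S|)%N ->
  (forall i, i \in S -> offsets x 0 i = offsets y 0 i) -> x = y.
Proof.
case/exists_subset_card=> K sKS cK xy.
have := alpha_generic (eq_leq cK).
set H := (\bigcap_(i in K) _)%VS => codimH.
suff xyH : x - y \in H.
  suff H0 : H = 0%VS by apply/eqP; rewrite -subr_eq0 -memv0 -H0.
  apply/eqP; rewrite -dimv_eq0; move: codimH (dimvS (subvf H)).
  by rewrite /codim dimvf /dim /= cK; lia.
apply/memv_bigcapP=> i /(fintype.subsetP sKS)/xy xyi.
by rewrite -offsets_eq0 linearB !mxE xyi subrr.
Qed.

(** The two common points lie on the same translates indexed by [S :&: T], at least [k] of them, and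
    therefore coincide. *)
Lemma concurrent_cap (S T : {set 'I_n}) : (k <= #|S :&: T|)%N ->
  (concurrent S :&: concurrent T <= concurrent (S :|: T))%VS.
Proof.
move=> leST; apply/subvP=> t /memv_capP[].
move=> /concurrentP[x tx] /concurrentP[y ty].
have xy : x = y.
  by apply: (offsets_inj leST) => i; rewrite inE => /andP[/tx-> /ty->].
apply/concurrentP; exists x => i; rewrite inE => /orP[/tx //|].
by rewrite xy => /ty.
Qed.

(** The sum defining [concurrent S] is direct, since a point whose offsets on [S] vanish is the
    origin. Its summands have dimension [k] and at least [n - #|S|]. *)
Lemma codim_concurrent (S : {set 'I_n}) : (k <= #|S|)%N ->
  (codim (concurrent S) <= #|S| - k)%N.
Proof.
move=> leS; rewrite /concurrent; set V := (\bigcap_(i in S) _)%VS.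
have codimV : (codim V <= #|S|)%N.
  apply: leq_trans (codim_bigcap _ _) _; rewrite -sum1_card leq_sum // => i _.
  by apply: leq_trans (codim_lker _) _.
have cap0 : (limg offsets :&: V = 0)%VS.
  apply/eqP; rewrite -subv0; apply/subvP=> t /memv_capP[].
  case/memv_imgP=> x _ -> /memv_bigcapP x0.
  rewrite (@offsets_inj S x 0) ?linear0 ?mem0v //.
  by move=> i /x0; rewrite mem_lker_coordinate => /eqP->; rewrite mxE.
have dim_limg : \dim (limg offsets) = k.
  have /eqP ker0 : lker offsets == 0%VS.
    rewrite -subv0; apply/subvP=> x.
    rewrite memv_ker memv0 => /eqP x0; apply/eqP/(@offsets_inj S) => // i _.
    by rewrite x0 linear0.
  move: (limg_ker_dim offsets fullv); rewrite ker0 capv0 dimv0 !dimvf.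
  by rewrite add0n => ->; rewrite /dim /= mul1n.
move: (dimv_sum_cap (limg offsets) V) codimV; rewrite cap0 dimv0 dim_limg.
move: (dimvS (subvf (limg offsets + V))) (dimvS (subvf V)).
rewrite /codim addn0; move: leS.
by move: #|S| (\dim V) (\dim (limg offsets + V)) (\dim fullv); lia.
Qed.

(* Translating [H_j] alone moves it off the common point, which the other
   hyperplanes determine. *)
Lemma delta_concurrent (S : {set 'I_n}) j : (k < #|S|)%N ->
  (delta_mx 0 j \in concurrent S) = (j \notin S).
Proof.
move=> ltS; apply/concurrentP/idP=> [[x xe]|jS].
  apply/negP=> jS; have x0 : x = 0.
    apply: (@offsets_inj (S :\ j)) => [|i].
      by move: ltS; rewrite (cardsD1 j) jS.
    by rewrite linear0 !inE => /andP[/negPf ij /xe->]; rewrite !mxE ij andbF.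
  by move: (xe j jS) => /esym/eqP; rewrite x0 linear0 !mxE !eqxx oner_eq0.
exists 0 => i iS; rewrite linear0 !mxE.
have [eij|_] := eqVneq i j; last by rewrite andbF.
by rewrite -eij iS in jS.
Qed.

(** Fix a set [K] of [k] indices in [S]. The translates in [K] already determine the common point of
    each [i |: K], so this point is the same for all [i]. *)
Lemma subset_DS (Y : {vspace 'rV[R]_n}) (S : {set 'I_n}) : (k < #|S|)%N ->
  ([set` Y] `<=` DS alpha S)%classic <-> (Y <= concurrent S)%VS.
Proof.
move=> ltS; split=> [YS|YS t tY L /= [sLS _]]; last first.
  by rewrite DLE; apply/(subvP (concurrentS sLS))/(subvP YS).
apply/subvP=> t /YS tS.
have [K sKS cK] := exists_subset_card (ltnW ltS).
have tL i : i \in S -> i \notin K -> t \in concurrent (i |: K).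
  move=> iS iK; have := tS (i |: K); rewrite DLE; apply; split.
    by rewrite finset.subUset finset.sub1set iS.
  by rewrite cardsU1 iK cK.
have : K \proper S by rewrite properEcard sKS cK.
case/properP=> _ [i0 i0S i0K]; have /concurrentP[x xt] := tL _ i0S i0K.
apply/concurrentP; exists x => i iS; have [iK|iK] := boolP (i \in K).
  by rewrite xt // !inE iK orbT.
have /concurrentP[y yt] := tL _ iS iK.
suff -> : x = y by rewrite yt // !inE eqxx.
by apply: (@offsets_inj K) => [|a aK]; rewrite ?cK // xt ?yt // !inE aK orbT.
Qed.

(** * Components *)

Lemma componentP (Y : {vspace 'rV[R]_n}) (S : {set 'I_n}) :
  reflect [/\ (k < #|S|)%N, (Y <= concurrent S)%VS &
              forall j, j \notin S -> ~~ (Y <= concurrent (j |: S))%VS]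
          (S \in presentation alpha Y).
Proof.
rewrite inE; have ltU j : (k < #|S|)%N -> (k < #|j |: S|)%N.
  by move=> ltS; apply: leq_trans ltS (subset_leq_card (finset.subsetUr _ _)).
apply: (iffP (asboolP _)) => [] [ltS YS Smax]; split=> // [|j jS].
- exact/subset_DS.
- by apply/negP=> /(subset_DS _ (ltU j ltS)); apply: Smax.
- exact/subset_DS.
- by move/(subset_DS _ (ltU j ltS)); apply/negP/Smax.
Qed.

(** Enlarging the index set shrinks [concurrent], so maximality against one extra index gives
    maximality under inclusion. *)
Lemma component_maximal (Y : {vspace 'rV[R]_n}) (S T : {set 'I_n}) :
  S \in presentation alpha Y -> S \subset T -> (Y <= concurrent T)%VS -> S = T.
Proof.
case/componentP=> _ _ Smax sST YT; apply/eqP; rewrite finset.eqEsubset sST.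
apply/fintype.subsetP=> i iT; apply/negPn/negP=> /Smax/negP; apply.
apply: subv_trans YT (concurrentS _).
by rewrite finset.subUset finset.sub1set iT.
Qed.

(** Sets sharing [k] indices glue by [concurrent_cap], and maximality makes each equal to the
    union. *)
Lemma component_inj (Y : {vspace 'rV[R]_n}) (S T : {set 'I_n}) :
  S \in presentation alpha Y -> T \in presentation alpha Y ->
  (k <= #|S :&: T|)%N -> S = T.
Proof.
move=> S_comp T_comp leST; have [_ YS _] := componentP _ _ S_comp.
have [_ YT _] := componentP _ _ T_comp.
have YST : (Y <= concurrent (S :|: T))%VS.
  by apply: subv_trans (concurrent_cap leST); rewrite subv_cap YS.
rewrite (component_maximal S_comp (finset.subsetUl _ T) YST).
by rewrite -(component_maximal T_comp (finset.subsetUr S _) YST).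
Qed.

Lemma sub_component (Y : {vspace 'rV[R]_n}) (L : {set 'I_n}) :
  (k < #|L|)%N -> (Y <= concurrent L)%VS ->
  exists2 S, S \in presentation alpha Y & L \subset S.
Proof.
move=> ltL YL; have [S /maxsetP[YS Smax] sLS] :=
  @maxset_exists _ (fun S => (Y <= concurrent S)%VS) L YL.
exists S => //; apply/componentP; split=> // [|j jS].
  exact: leq_trans ltL (subset_leq_card sLS).
apply: contra jS => /Smax/(_ (finset.subsetUr _ _)) {1}<-.
by rewrite !inE eqxx.
Qed.

(** * The intersection poset *)

Lemma in_posetP (Y : {vspace 'rV[R]_n}) :
  in_poset alpha Y <->
  exists2 F : {set {set 'I_n}}, forall L, L \in F -> #|L| = k.+1 &
    Y = (\bigcap_(L in F) concurrent L)%VS.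
Proof.
split=> [] [F F_card YF]; exists F => //.
  apply/vspaceP=> t; apply/idP/memv_bigcapP => [tY L LF|tF].
    by have : [set` Y]%classic t by []; rewrite YF => /(_ L LF); rewrite DLE.
  suff : [set` Y]%classic t by [].
  by rewrite YF => L LF; rewrite DLE; apply: tF.
rewrite YF; apply/seteqP; split=> [t /memv_bigcapP tF L LF|t tF].
  by rewrite DLE; apply: tF.
by apply/memv_bigcapP=> L LF; have := tF L LF; rewrite DLE.
Qed.

(** Every [L] of a defining family lies in some component, which imposes at least as strong a
    condition. *)
Lemma poset_bigcap_components (Y : {vspace 'rV[R]_n}) : in_poset alpha Y ->
  Y = (\bigcap_(S in presentation alpha Y) concurrent S)%VS.
Proof.
case/in_posetP=> F F_card YF; apply/eqP; rewrite eqEsubv; apply/andP; split.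
  by apply/subv_bigcapP=> S /componentP[].
rewrite [X in (_ <= X)%VS]YF; apply/subv_bigcapP=> L LF.
have [||S S_comp sLS] := @sub_component Y L; first by rewrite F_card.
  by rewrite YF; apply: (bigcapv_inf L LF (subvv _)).
exact: subv_trans (bigcapv_inf S S_comp (subvv _)) (concurrentS sLS).
Qed.

(** Codimension is subadditive under intersection. Failure of very genericity is thus always a
    strict inequality. *)
Lemma codim_le_ath_rank (Y : {vspace 'rV[R]_n}) : in_poset alpha Y ->
  (codim Y <= ath_rank alpha Y)%N.
Proof.
move/poset_bigcap_components=> {1}->; apply: leq_trans (codim_bigcap _ _) _.
apply: leq_sum => S /componentP[ltS _ _]; exact/codim_concurrent/ltnW.
Qed.

(** * Forgetting an index *)

Definition forget (Y : {vspace 'rV[R]_n}) (j : 'I_n) : {vspace 'rV[R]_n} :=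
  (\bigcap_(L in [set L : {set 'I_n} |
     [&& #|L| == k.+1, j \notin L & (Y <= concurrent L)%VS]]) concurrent L)%VS.

Lemma forget_in_poset Y j : in_poset alpha (forget Y j).
Proof. by apply/in_posetP; eexists=> // L; rewrite inE => /andP[/eqP]. Qed.

Lemma sub_forget Y j : (Y <= forget Y j)%VS.
Proof. by apply/subv_bigcapP=> L; rewrite inE => /and3P[]. Qed.

Lemma delta_forget Y j : delta_mx 0 j \in forget Y j.
Proof.
apply/memv_bigcapP=> L; rewrite inE => /and3P[/eqP cL jL _].
by rewrite delta_concurrent ?cL.
Qed.

Lemma forget_proper Y j : j \in finset.cover (presentation alpha Y) ->
  forget Y j != Y.
Proof.
case/bigcupP=> S /componentP[ltS YS _] jS; apply/eqP=> eqY.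
move/subvP/(_ (delta_mx 0 j)): YS.
by rewrite -{1}eqY delta_forget delta_concurrent // jS => /(_ isT).
Qed.

(** The family in [forget] takes every admissible [L], not only those of some family defining [Y];
    it therefore contains all [L] of size [k.+1] inside [S]. *)
Lemma forget_sub_concurrent Y j (S : {set 'I_n}) : (k < #|S|)%N ->
  (Y <= concurrent S)%VS -> j \notin S -> (forget Y j <= concurrent S)%VS.
Proof.
move=> ltS YS jS; apply/subset_DS => // t tY L /= [sLS cL]; rewrite DLE.
apply: (subvP _ _ tY); apply/(bigcapv_inf L _ (subvv _)).
rewrite inE cL eqxx (subv_trans YS (concurrentS sLS)) andbT.
by apply: contra jS; apply: fintype.subsetP.
Qed.

(** Suppose [S :\ j] could be enlarged by [i]. The case [i = j] fails because [H_j] moves freely;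
    otherwise [i |: S :\ j] glues with [S] along [S :\ j], against the maximality of [S] for [Y]. *)
Lemma forget_component Y j (S : {set 'I_n}) :
  S \in presentation alpha Y -> (k < #|S :\ j|)%N ->
  S :\ j \in presentation alpha (forget Y j).
Proof.
move=> S_comp ltSj; have [ltS YS _] := componentP _ _ S_comp.
apply/componentP; split=> // [|i iSj].
  apply: forget_sub_concurrent => //; last by rewrite !inE eqxx.
  exact: subv_trans YS (concurrentS (subD1set _ _)).
apply/negP=> YiSj; have [eij|neij] := eqVneq i j.
  move/subvP/(_ _ (delta_forget Y j)): YiSj.
  rewrite delta_concurrent ?eij ?inE ?eqxx //.
  exact: leq_trans ltSj (subset_leq_card (finset.subsetUr _ _)).
have iS : i \notin S by move: iSj; rewrite !inE neij.
have [_ _ /(_ i iS)/negP] := componentP _ _ S_comp; apply.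
have -> : i |: S = (i |: S :\ j) :|: S.
  by rewrite -finset.setUA (finset.setUidPr (subD1set _ _)).
apply: subv_trans (concurrent_cap _); last first.
  apply: leq_trans (ltnW ltSj) (subset_leq_card _).
  by rewrite finset.subsetI finset.subsetUr subD1set.
by rewrite subv_cap YS (subv_trans (sub_forget Y j)).
Qed.

(** Deleting [j] lowers the term [#|S| - k] by one exactly for the components containing [j]. *)
Lemma ath_rank_forget Y j :
  (ath_rank alpha Y <= ath_rank alpha (forget Y j) + multiplicity alpha Y j)%N.
Proof.
(* The components left out of [P] have [#|S :\ j| = k], so their truncated difference is 0. *)
pose P := [pred S in presentation alpha Y | (k < #|S :\ j|)%N].
have injD1 : {in P &, injective (fun S : {set 'I_n} => S :\ j)}.
  move=> S T /andP[S_comp ltS] /andP[T_comp _] /= eqST.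
  apply: component_inj S_comp T_comp _.
  apply: leq_trans (ltnW ltS) (subset_leq_card _).
  by rewrite finset.subsetI {2}eqST !subD1set.
have le_forget :
  (\sum_(S in P) (#|S :\ j| - k) <= ath_rank alpha (forget Y j))%N.
  rewrite -(big_imset (fun S : {set 'I_n} => #|S| - k)%N injD1) /=.
  (* Components of [forget Y j] that do not come from [P] can only increase the right-hand side. *)
  rewrite /ath_rank [X in (_ <= X)%N](bigID (mem [set S :\ j | S in P])) /=.
  apply: leq_trans (leq_addr _ _); apply: eq_leq; apply: eq_bigl => T.
  rewrite andb_idl // => /imsetP[S /andP[S_comp ltS] ->].
  exact: forget_component.
apply: (@leq_trans
  (\sum_(S in presentation alpha Y) ((#|S :\ j| - k) + (j \in S)))%N).
  apply: leq_sum => S _; rewrite [#|S|](cardsD1 j).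
  by rewrite leq_subLR addnA addnC leq_add2r -leq_subLR.
rewrite big_split leq_add //=; last first.
  by rewrite /multiplicity -sum1_card big_mkcondr.
apply: leq_trans le_forget.
rewrite [X in (_ <= X)%N]big_mkcondr leq_sum // => S _.
by case: ltnP => //; rewrite -subn_eq0 => /eqP->.
Qed.

(** * Multiplicities and double counting *)

Lemma ell_le Y j : j \in finset.cover (presentation alpha Y) ->
  (ell alpha Y <= multiplicity alpha Y j)%N.
Proof. exact: (@Order.TotalTheory.bigmin_le_cond _ nat). Qed.

Lemma multiplicity_le Y j :
  (multiplicity alpha Y j <= #|presentation alpha Y|)%N.
Proof. by apply/subset_leq_card/fintype.subsetP=> S /andP[]. Qed.

Lemma ell_attained Y : finset.cover (presentation alpha Y) != finset.set0 ->
  exists2 j, j \in finset.cover (presentation alpha Y) &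
    ell alpha Y = multiplicity alpha Y j.
Proof.
case/set0Pn=> j0 j0Y.
have [j jY ellj] := @Order.TotalTheory.eq_bigmin _ nat _ #|presentation alpha Y|
  j0 [in finset.cover (presentation alpha Y)] (multiplicity alpha Y) j0Y
  (fun j _ => multiplicity_le Y j).
by exists j.
Qed.

Lemma sum_card_components Y :
  (\sum_(S in presentation alpha Y) #|S| =
   \sum_(j in finset.cover (presentation alpha Y)) multiplicity alpha Y j)%N.
Proof.
under [RHS]eq_bigr => j _ do rewrite /multiplicity -sum1_card.
rewrite (exchange_big_dep [in presentation alpha Y]) /=; last first.
  by move=> j S _ /andP[].
apply: eq_bigr => S S_comp; rewrite -sum1_card; apply: eq_bigl => j.
rewrite inE S_comp /= andb_idl // => jS.
by apply/bigcupP; exists S.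
Qed.

End Translates.

Theorem theorem4p3 (R : realType) (n k : nat) (hkn : (k < n)%N)
    (alpha : 'I_n -> 'rV[R]_k) (halpha : forall i, alpha i != 0)
    (hgen : generic alpha)
    (X : {vspace 'rV[R]_n}) (hX : minimal_non_very_generic alpha X) :
  [/\ (2 <= ell alpha X <= k)%N,
      (ath_rank alpha X)%:R >=
        (ell alpha X)%:R * #|finset.cover (presentation alpha X)|%:R / k.+1%:R :> R &
      (codim X < ath_rank alpha X < codim X + ell alpha X)%N].
Proof.
case: hX => X_poset X_nvg X_min.
set P := presentation alpha X; set U := finset.cover P.
have lt_rank : (codim X < ath_rank alpha X)%N.
  by rewrite ltn_neqAle codim_le_ath_rank // andbT; apply/eqP.
have component_gt S : S \in P -> (k < #|S|)%N by case/componentP.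
have component_sub S : S \in P -> S \subset U.
  by move=> SP; apply: (finset.bigcup_sup S).
(* With no component the Athanasiadis rank would be 0, which cannot exceed the codimension. *)
have [S0 S0P] : exists S, S \in P.
  apply/set0Pn; apply: contraTneq lt_rank; rewrite /P /ath_rank => ->.
  by rewrite big_set0.
have ltU : (k < #|U|)%N.
  exact: leq_trans (component_gt _ S0P) (subset_leq_card (component_sub _ S0P)).
have [|j jU ellj] := @ell_attained _ _ _ alpha X.
  by rewrite -card_gt0; apply: leq_ltn_trans ltU.
have lt_ath : (ath_rank alpha X < codim X + ell alpha X)%N.
  have Yvg := X_min _ (forget_in_poset halpha X j) (sub_forget _ _ _)
    (forget_proper halpha hgen jU).
  have ltYX : (codim (forget alpha X j) < codim X)%N.
    rewrite ltn_neqAle codimS ?sub_forget // andbT.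
    apply: contraNneq (forget_proper halpha hgen jU) => eqYX.
    by apply/eqP/esym/codim_eq; rewrite ?sub_forget.
  have := ath_rank_forget halpha hgen X j; rewrite -Yvg -ellj => le_ath.
  by apply: leq_ltn_trans le_ath _; rewrite ltn_add2r.
have lt_codim : (codim X < #|U| - k)%N.
  have sUX : (concurrent alpha U <= X)%VS.
    rewrite [X in (_ <= X)%VS](poset_bigcap_components halpha hgen X_poset).
    by apply/subv_bigcapP=> S /component_sub/concurrentS.
  have leXU := codim_concurrent halpha hgen (ltnW ltU).
  rewrite ltn_neqAle (leq_trans (codimS sUX) leXU) andbT.
  apply/eqP=> eqX; have eqXU : X = concurrent alpha U.
    apply/esym/codim_eq => //; apply/eqP; rewrite eqn_leq (codimS sUX).
    by rewrite eqX leXU.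
  have P_U S : S \in P -> S = U.
    move=> SP; apply: (component_maximal halpha hgen SP (component_sub _ SP)).
    by rewrite eqXU.
  (* With [U] as the only component no multiplicity exceeds 1, and no integer lies strictly between
     [codim X] and [codim X + 1]. *)
  have : (ell alpha X <= 1)%N.
    rewrite ellj -(cards1 U); apply/subset_leq_card/fintype.subsetP.
    move=> S /andP[/P_U-> _].
    by rewrite inE.
  by move: lt_rank lt_ath; lia.
have le_sum : (ell alpha X * #|U| <= k.+1 * ath_rank alpha X)%N.
  apply: (@leq_trans (\sum_(S in P) #|S|)%N).
    rewrite sum_card_components mulnC -sum_nat_const leq_sum // => i.
    exact: ell_le.
  rewrite /ath_rank big_distrr /= leq_sum // => S /component_gt ltS.
  (* With [m = #|S| - k], positive for a component, [#|S| = m + k <= m + k * m]. *)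
  by rewrite -{1}(subnK (ltnW ltS)) mulSn leq_add2l leq_pmulr ?subn_gt0.
split; last by rewrite lt_rank lt_ath.
  apply/andP; split; first by move: lt_rank lt_ath; lia.
  rewrite leqNgt; apply/negP=> lt_ell.
  (* Put [#|U| = k + 1 + d] and [ell alpha X = k + 1 + e]. The rank is at most [d], so the
     Athanasiadis rank is at most [k + e + d]; but [(k + 1)(k + e + d) < (k + 1 + e)(k + 1 + d)],
     against [le_sum]. *)
  have eqU : #|U| = (k.+1 + (#|U| - k.+1))%N by rewrite subnKC.
  have eql : ell alpha X = (k.+1 + (ell alpha X - k.+1))%N by rewrite subnKC.
  move: lt_ath lt_codim le_sum; rewrite eqU eql.
  move: (codim X) (ath_rank alpha X) (ell alpha X - k.+1)%N (#|U| - k.+1)%N.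
  move=> r a e d lt_a lt_r; apply/negP; rewrite -ltnNge.
  apply: (@leq_ltn_trans (k.+1 * (k + e + d))); first by rewrite leq_mul2l; lia.
  by nia.
by rewrite ler_pdivrMr ?ltr0n // -!natrM ler_nat [leqRHS]mulnC.
Qed.
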